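(* Let $m\in\mathbb{R}\setminus\{-1,0,1\}$. Then Bour's surface $\mathfrak{B}_m(r,\theta)=(x(r,\theta),y(r,\theta),z(r,\theta))$ given by $$x=-\frac{r^{m-1}}{m-1}\left(\cos^{m-1}\theta-\sin^{m-1}\theta\right)-\frac{r^{m+1}}{m+1}\left(\cos^{m+1}\theta-\sin^{m+1}\theta\right),$$ $$y=\frac{r^{m-1}}{m-1}\left(\cos^{m-1}\theta+\sin^{m-1}\theta\right)-\frac{r^{m+1}}{m+1}\left(\cos^{m+1}\theta+\sin^{m+1}\theta\right),$$ $$z=2\,\frac{r^{m}}{m}\left(\cos^{m}\theta+\sin^{m}\theta\right)$$ is a timelike minimal surface in the Minkowski space $\mathbb{L}^3$ (with metric $-dx^2+dy^2+dz^2$).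
   Context: $\mathbb{L}^3$ denotes the 3-dimensional Minkowski space with coordinates $(x,y,z)$ and the Lorentzian metric $\langle\cdot,\cdot\rangle=-dx^2+dy^2+dz^2$. Here $\cos^{p}\theta$ and $\sin^{p}\theta$ mean $(\cos\theta)^p$ and $(\sin\theta)^p$, and $(r,\theta)$ are real parameters. Surfaces are assumed smooth and simply connected. A surface in $\mathbb{L}^3$ is called timelike if the induced metric on the surface is a Lorentzian metric. A timelike minimal surface is a timelike surface whose mean curvature $H$ vanishes identically; here, for a parametrized surface $X(r,\theta)$ with first fundamental form coefficients $E=\langle X_r,X_r\rangle$, $F=\langle X_r,X_\theta\rangle$, $G=\langle X_\theta,X_\theta\rangle$, unit normal $e$, and second fundamental form coefficients $L=\langle X_{rr},e\rangle$, $M=\langle X_{r\theta},e\rangle$, $N=\langle X_{\theta\theta},e\rangle$, the mean curvature is, up to a sign convention, $H=\dfrac{EN-2FM+GL}{2(EG-F^2)}$. *)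

(* Defs.v *)
From Stdlib Require Import Reals Lra ZArith.
From Coquelicot Require Import Coquelicot.
Open Scope R_scope.

(* Minkowski 3-space, metric -dx^2 + dy^2 + dz^2. *)
Definition L3 : Type := (R * R * R)%type.
Definition mkL3 (a b c : R) : L3 := (a, b, c).
Definition cx (v : L3) : R := fst (fst v).
Definition cy (v : L3) : R := snd (fst v).
Definition cz (v : L3) : R := snd v.

Definition mink (v w : L3) : R := - (cx v * cx w) + cy v * cy w + cz v * cz w.

Definition addL3 (v w : L3) : L3 := mkL3 (cx v + cx w) (cy v + cy w) (cz v + cz w).
Definition scaleL3 (k : R) (v : L3) : L3 := mkL3 (k * cx v) (k * cy v) (k * cz v).

(* Lorentzian cross product, characterised by mink (crossL3 v w) u = det (v, w, u). *)
Definition crossL3 (v w : L3) : L3 :=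
  mkL3 (- (cy v * cz w - cz v * cy w))
       (cz v * cx w - cx v * cz w)
       (cx v * cy w - cy v * cx w).

Definition d1 (f : R -> R -> R) (r t : R) : R := Derive (fun s => f s t) r.
Definition d2 (f : R -> R -> R) (r t : R) : R := Derive (fun s => f r s) t.

(* [Derive] is total (junk value where the derivative does not exist), hence
   the explicit [ex_derive] requirements.  Meaningful for open [D]. *)
Fixpoint Ck (n : nat) (D : R * R -> Prop) (f : R -> R -> R) : Prop :=
  (forall p, D p -> continuous (fun q : R * R => f (fst q) (snd q)) p) /\
  match n with
  | O => True
  | S k =>
      (forall r t, D (r, t) ->
         ex_derive (fun s => f s t) r /\ ex_derive (fun s => f r s) t) /\
      Ck k D (d1 f) /\ Ck k D (d2 f)
  end.

Definition smooth_on (D : R * R -> Prop) (f : R -> R -> R) : Prop :=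
  forall n, Ck n D f.

Definition smooth_map (D : R * R -> Prop) (X : R -> R -> L3) : Prop :=
  smooth_on D (fun r t => cx (X r t)) /\
  smooth_on D (fun r t => cy (X r t)) /\
  smooth_on D (fun r t => cz (X r t)).

Definition dr (X : R -> R -> L3) (r t : R) : L3 :=
  mkL3 (d1 (fun a b => cx (X a b)) r t)
       (d1 (fun a b => cy (X a b)) r t)
       (d1 (fun a b => cz (X a b)) r t).
Definition dt (X : R -> R -> L3) (r t : R) : L3 :=
  mkL3 (d2 (fun a b => cx (X a b)) r t)
       (d2 (fun a b => cy (X a b)) r t)
       (d2 (fun a b => cz (X a b)) r t).

Definition differential (X : R -> R -> L3) (r t : R) (a : R * R) : L3 :=
  addL3 (scaleL3 (fst a) (dr X r t)) (scaleL3 (snd a) (dt X r t)).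

Definition immersion_at (X : R -> R -> L3) (r t : R) : Prop :=
  forall a : R * R, differential X r t a = mkL3 0 0 0 -> a = (0, 0).

Definition induced_metric (X : R -> R -> L3) (r t : R) (a b : R * R) : R :=
  mink (differential X r t a) (differential X r t b).

(* Signature (-,+) of a symmetric bilinear form on the plane, through an
   orthonormal basis (two such vectors are automatically independent). *)
Definition lorentzian (g : R * R -> R * R -> R) : Prop :=
  exists a b : R * R, g a a = -1 /\ g b b = 1 /\ g a b = 0.

Definition coefE (X : R -> R -> L3) (r t : R) : R := mink (dr X r t) (dr X r t).
Definition coefF (X : R -> R -> L3) (r t : R) : R := mink (dr X r t) (dt X r t).
Definition coefG (X : R -> R -> L3) (r t : R) : R := mink (dt X r t) (dt X r t).

(* The other unit normal is the opposite one; it changes the sign of the mean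
   curvature. *)
Definition unit_normal (X : R -> R -> L3) (r t : R) : L3 :=
  let n := crossL3 (dr X r t) (dt X r t) in
  scaleL3 (/ sqrt (Rabs (mink n n))) n.

Definition coefL (X : R -> R -> L3) (r t : R) : R :=
  mink (dr (dr X) r t) (unit_normal X r t).
Definition coefM (X : R -> R -> L3) (r t : R) : R :=
  mink (dt (dr X) r t) (unit_normal X r t).
Definition coefN (X : R -> R -> L3) (r t : R) : R :=
  mink (dt (dt X) r t) (unit_normal X r t).

Definition mean_curvature (X : R -> R -> L3) (r t : R) : R :=
  (coefE X r t * coefN X r t - 2 * coefF X r t * coefM X r t
     + coefG X r t * coefL X r t)
  / (2 * (coefE X r t * coefG X r t - (coefF X r t) ^ 2)).

(* Paths and homotopies are total continuous maps whose values matter only on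
   [0,1] and [0,1]^2; every continuous map on these extends to such a map by
   composing with the retraction onto the interval or the square. *)
Definition path_connected (D : R * R -> Prop) : Prop :=
  forall p q, D p -> D q ->
  exists c : R -> R * R,
    (forall t, continuous c t) /\ (forall t, 0 <= t <= 1 -> D (c t)) /\
    c 0 = p /\ c 1 = q.

Definition null_homotopic_in (D : R * R -> Prop) (c : R -> R * R) : Prop :=
  exists h : R * R -> R * R,
    (forall st, continuous h st) /\
    (forall s t, 0 <= s <= 1 -> 0 <= t <= 1 -> D (h (s, t))) /\
    (forall t, 0 <= t <= 1 -> h (0, t) = c t /\ h (1, t) = c 0) /\
    (forall s, 0 <= s <= 1 -> h (s, 0) = c 0 /\ h (s, 1) = c 0).

Definition simply_connected (D : R * R -> Prop) : Prop :=
  path_connected D /\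
  forall c : R -> R * R,
    (forall t, continuous c t) -> (forall t, 0 <= t <= 1 -> D (c t)) ->
    c 0 = c 1 -> null_homotopic_in D c.

Definition surface (D : R * R -> Prop) (X : R -> R -> L3) : Prop :=
  open D /\ simply_connected D /\ smooth_map D X /\
  forall r t, D (r, t) -> immersion_at X r t.

Definition timelike_surface (D : R * R -> Prop) (X : R -> R -> L3) : Prop :=
  surface D X /\ forall r t, D (r, t) -> lorentzian (induced_metric X r t).

Definition timelike_minimal_surface (D : R * R -> Prop) (X : R -> R -> L3) : Prop :=
  timelike_surface D X /\ forall r t, D (r, t) -> mean_curvature X r t = 0.

(* Real powers x^a.  For x > 0 this is exp (a ln x); for x <= 0 it is
   meaningful when a is an integer, namely a = IZR (Int_part a), under the
   condition [pow_defined]. *)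
Definition rpow (x a : R) : R :=
  if Rlt_dec 0 x then Rpower x a else powerRZ x (Int_part a).

Definition pow_defined (x a : R) : Prop :=
  0 < x \/ exists k : Z, a = IZR k /\ (x <> 0 \/ (0 < k)%Z).

Lemma rpow_IZR (x : R) (k : Z) : rpow x (IZR k) = powerRZ x k.
Proof.
unfold rpow; destruct (Rlt_dec 0 x) as [hx | hx].
- symmetry; apply powerRZ_Rpower; exact hx.
- f_equal; unfold Int_part.
  rewrite <- (tech_up (IZR k) (k + 1)); [ring | |]; rewrite plus_IZR; lra.
Qed.

Lemma mink_crossL3 (v w : L3) :
  mink (crossL3 v w) v = 0 /\ mink (crossL3 v w) w = 0 /\
  mink (crossL3 v w) (crossL3 v w) = - (mink v v * mink w w - (mink v w) ^ 2).
Proof. unfold mink, crossL3, mkL3, cx, cy, cz; simpl; repeat split; ring. Qed.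

Definition bour (m r t : R) : L3 :=
  mkL3
    (- (rpow r (m - 1) / (m - 1)) * (rpow (cos t) (m - 1) - rpow (sin t) (m - 1))
     - rpow r (m + 1) / (m + 1) * (rpow (cos t) (m + 1) - rpow (sin t) (m + 1)))
    (rpow r (m - 1) / (m - 1) * (rpow (cos t) (m - 1) + rpow (sin t) (m - 1))
     - rpow r (m + 1) / (m + 1) * (rpow (cos t) (m + 1) + rpow (sin t) (m + 1)))
    (2 * (rpow r m / m) * (rpow (cos t) m + rpow (sin t) m)).

Definition bour_defined (m r t : R) : Prop :=
  forall x a : R, (x = r \/ x = cos t \/ x = sin t) ->
    (a = m - 1 \/ a = m \/ a = m + 1) -> pow_defined x a.

(* On this quadrant every power is defined, whatever the real exponent. *)
Definition bour_quadrant (p : R * R) : Prop :=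
  0 < fst p /\ 0 < snd p < PI / 2.

(* Main.v *)
(* With u = r cos t and v = r sin t, Bour's surface is a sum X = A(u) + B(v) of two
   null curves: <A',A'> = 0 because u^(m-2) u^m = (u^(m-1))^2, and likewise for B.
   Hence the tangent plane is spanned by the null vectors A' and B'. They are
   independent exactly when <A',B'> <> 0, since two orthogonal null vectors are
   dependent, and then the metric has signature (-,+). The mixed derivative of X in
   (u, v) vanishes, which makes the mean curvature zero.

   Smoothness holds because the coordinates lie in a class of expressions closed
   under both partial derivatives. *)

From Stdlib Require Import Reals ZArith Lra Lia.
From Coquelicot Require Import Coquelicot.
(* Last, because [Reals] also exports names [d1] and [d2]. *)
Require Import Defs.
Open Scope R_scope.

(** * Partial derivatives and smoothness of elementary expressions *)

Lemma open_slice1 (D : R * R -> Prop) (r t : R) :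
  open D -> D (r, t) -> locally r (fun s => D (s, t)).
Proof.
intros hD h; destruct (hD _ h) as [eps heps]; exists eps; intros s hs.
apply heps; split; [exact hs | apply ball_center].
Qed.

Lemma open_slice2 (D : R * R -> Prop) (r t : R) :
  open D -> D (r, t) -> locally t (fun s => D (r, s)).
Proof.
intros hD h; destruct (hD _ h) as [eps heps]; exists eps; intros s hs.
apply heps; split; [apply ball_center | exact hs].
Qed.

(** A partial derivative depends only on the values along a slice near the point, and that slice
    stays in the open set [D] for a while. This allows a formula valid only on [D] to be
    differentiated. *)
Lemma d1_ext_open (D : R * R -> Prop) (f g : R -> R -> R) (r t : R) :
  open D -> (forall r t, D (r, t) -> f r t = g r t) -> D (r, t) ->
  d1 f r t = d1 g r t.
Proof.
intros hD hfg h; apply Derive_ext_loc.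
eapply filter_imp; [| exact (open_slice1 _ _ _ hD h)]; intros s; apply hfg.
Qed.

Lemma d2_ext_open (D : R * R -> Prop) (f g : R -> R -> R) (r t : R) :
  open D -> (forall r t, D (r, t) -> f r t = g r t) -> D (r, t) ->
  d2 f r t = d2 g r t.
Proof.
intros hD hfg h; apply Derive_ext_loc.
eapply filter_imp; [| exact (open_slice2 _ _ _ hD h)]; intros s; apply hfg.
Qed.

Lemma is_derive_Rpower (a x : R) :
  0 < x -> is_derive (fun y => Rpower y a) x (a * Rpower x (a - 1)).
Proof.
intros hx; apply is_derive_Reals, derivable_pt_lim_power; exact hx.
Qed.

(* [el_ext] makes the class closed under [d1] and [d2] themselves, so that [Ck]
   follows by induction on the order. *)
Inductive elementary (D : R * R -> Prop) : (R -> R -> R) -> Prop :=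
| el_const c : elementary D (fun _ _ => c)
| el_fst : elementary D (fun r _ => r)
| el_cos : elementary D (fun _ t => cos t)
| el_sin : elementary D (fun _ t => sin t)
| el_plus f g : elementary D f -> elementary D g ->
    elementary D (fun r t => f r t + g r t)
| el_mult f g : elementary D f -> elementary D g ->
    elementary D (fun r t => f r t * g r t)
| el_inv f : (forall r t, D (r, t) -> f r t <> 0) -> elementary D f ->
    elementary D (fun r t => / f r t)
| el_Rpower f a : (forall r t, D (r, t) -> 0 < f r t) -> elementary D f ->
    elementary D (fun r t => Rpower (f r t) a)
| el_ext f g : (forall r t, D (r, t) -> f r t = g r t) -> elementary D f ->
    elementary D g.

Lemma elementary_continuous (D : R * R -> Prop) (f : R -> R -> R) :
  open D -> elementary D f ->
  forall p, D p -> continuous (fun q : R * R => f (fst q) (snd q)) p.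
Proof.
intros hD hf; induction hf as [c | | | | f g _ IHf _ IHg | f g _ IHf _ IHg
  | f h0 _ IHf | f a h0 _ IHf | f g hfg _ IHf]; intros p hp.
- apply continuous_const.
- apply continuous_fst.
- apply (continuous_comp snd cos); [apply continuous_snd | apply continuous_cos].
- apply (continuous_comp snd sin); [apply continuous_snd | apply continuous_sin].
- apply (continuous_plus (fun q : R * R => f (fst q) (snd q))); auto.
- apply (continuous_mult (fun q : R * R => f (fst q) (snd q))); auto.
- apply (continuous_comp (fun q : R * R => f (fst q) (snd q)) Rinv); [auto |].
  apply continuous_Rinv, h0; destruct p; exact hp.
- apply (continuous_comp (fun q : R * R => f (fst q) (snd q))
    (fun x => Rpower x a)); [auto |].
  apply (ex_derive_continuous (V := R_NormedModule)); eexists.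
  apply is_derive_Rpower, h0; destruct p; exact hp.
- apply (continuous_ext_loc _ (fun q : R * R => f (fst q) (snd q))); [| auto].
  apply (filter_imp D); [intros [r t]; apply hfg | exact (hD p hp)].
Qed.

(** Each differentiation rule stays inside the class. Closure and existence go through one induction
    because the rules for [Derive] require the derivatives of the parts to exist. *)
Lemma elementary_d1 (D : R * R -> Prop) (f : R -> R -> R) :
  open D -> elementary D f ->
  elementary D (d1 f) /\
  forall r t, D (r, t) -> ex_derive (fun s => f s t) r.
Proof.
intros hD hf; induction hf as [c | | | | f g ef [df IHf] eg [dg IHg]
  | f g ef [df IHf] eg [dg IHg] | f h0 ef [df IHf] | f a h0 ef [df IHf]
  | f g hfg ef [df IHf]]; unfold d1; (split; [| intros r t h]).
- apply (el_ext _ (fun _ _ => 0)); [| constructor].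
  intros; symmetry; apply Derive_const.
- apply ex_derive_const.
- apply (el_ext _ (fun _ _ => 1)); [| constructor].
  intros; symmetry; apply Derive_id.
- apply ex_derive_id.
- apply (el_ext _ (fun _ _ => 0)); [| constructor].
  intros; symmetry; apply Derive_const.
- apply ex_derive_const.
- apply (el_ext _ (fun _ _ => 0)); [| constructor].
  intros; symmetry; apply Derive_const.
- apply ex_derive_const.
- apply (el_ext _ (fun r t => d1 f r t + d1 g r t)); [| constructor; auto].
  intros r t h; symmetry; apply Derive_plus; auto.
- apply (ex_derive_plus (V := R_NormedModule)); auto.
- apply (el_ext _ (fun r t => d1 f r t * g r t + f r t * d1 g r t)).
  + intros r t h; symmetry; apply Derive_mult; auto.
  + repeat (constructor; auto).
- apply ex_derive_mult; auto.
(* The derivative of [/ f] is written with constants, products and inverses only, so that the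
   constructors of the class apply. *)
- apply (el_ext _ (fun r t => -1 * (d1 f r t * (/ f r t * / f r t)))).
  + intros r t h; rewrite Derive_inv; auto.
    change (-1 * (d1 f r t * (/ f r t * / f r t)) = - d1 f r t / f r t ^ 2).
    field; auto.
  + repeat (constructor; auto).
- apply ex_derive_inv; auto.
- apply (el_ext _ (fun r t => d1 f r t * (a * Rpower (f r t) (a - 1)))).
  + intros r t h; symmetry; apply is_derive_unique.
    apply (is_derive_comp (fun x => Rpower x a) (fun s => f s t)).
    * apply is_derive_Rpower; auto.
    * apply Derive_correct; auto.
  + repeat (constructor; auto).
- apply (ex_derive_comp (fun x => Rpower x a) (fun s => f s t)); auto.
  eexists; apply is_derive_Rpower; auto.
- apply (el_ext _ (d1 f)); [| exact df].
  intros r t h; apply (d1_ext_open D f g); auto.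
- apply (ex_derive_ext_loc (fun s => f s t)); [| exact (IHf r t h)].
  eapply filter_imp; [| exact (open_slice1 _ _ _ hD h)].
  intros s; exact (hfg _ _).
Qed.

Lemma elementary_d2 (D : R * R -> Prop) (f : R -> R -> R) :
  open D -> elementary D f ->
  elementary D (d2 f) /\
  forall r t, D (r, t) -> ex_derive (fun s => f r s) t.
Proof.
intros hD hf; induction hf as [c | | | | f g ef [df IHf] eg [dg IHg]
  | f g ef [df IHf] eg [dg IHg] | f h0 ef [df IHf] | f a h0 ef [df IHf]
  | f g hfg ef [df IHf]]; unfold d2; (split; [| intros r t h]).
- apply (el_ext _ (fun _ _ => 0)); [| constructor].
  intros; symmetry; apply Derive_const.
- apply ex_derive_const.
- apply (el_ext _ (fun _ _ => 0)); [| constructor].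
  intros; symmetry; apply Derive_const.
- apply ex_derive_const.
- apply (el_ext _ (fun _ t => -1 * sin t)); [| repeat constructor].
  intros r t _; symmetry; apply is_derive_unique; auto_derive; [exact I | ring].
- auto_derive; exact I.
- apply (el_ext _ (fun _ t => cos t)); [| repeat constructor].
  intros r t _; symmetry; apply is_derive_unique; auto_derive; [exact I | ring].
- auto_derive; exact I.
- apply (el_ext _ (fun r t => d2 f r t + d2 g r t)); [| constructor; auto].
  intros r t h; symmetry; apply Derive_plus; auto.
- apply (ex_derive_plus (V := R_NormedModule)); auto.
- apply (el_ext _ (fun r t => d2 f r t * g r t + f r t * d2 g r t)).
  + intros r t h; symmetry; apply Derive_mult; auto.
  + repeat (constructor; auto).
- apply ex_derive_mult; auto.
- apply (el_ext _ (fun r t => -1 * (d2 f r t * (/ f r t * / f r t)))).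
  + intros r t h; rewrite Derive_inv; auto.
    change (-1 * (d2 f r t * (/ f r t * / f r t)) = - d2 f r t / f r t ^ 2).
    field; auto.
  + repeat (constructor; auto).
- apply ex_derive_inv; auto.
- apply (el_ext _ (fun r t => d2 f r t * (a * Rpower (f r t) (a - 1)))).
  + intros r t h; symmetry; apply is_derive_unique.
    apply (is_derive_comp (fun x => Rpower x a) (fun s => f r s)).
    * apply is_derive_Rpower; auto.
    * apply Derive_correct; auto.
  + repeat (constructor; auto).
- apply (ex_derive_comp (fun x => Rpower x a) (fun s => f r s)); auto.
  eexists; apply is_derive_Rpower; auto.
- apply (el_ext _ (d2 f)); [| exact df].
  intros r t h; apply (d2_ext_open D f g); auto.
- apply (ex_derive_ext_loc (fun s => f r s)); [| exact (IHf r t h)].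
  eapply filter_imp; [| exact (open_slice2 _ _ _ hD h)].
  intros s; exact (hfg _ _).
Qed.

Lemma elementary_smooth (D : R * R -> Prop) (f : R -> R -> R) :
  open D -> elementary D f -> smooth_on D f.
Proof.
intros hD hf n; revert f hf; induction n as [| n IH]; intros f hf; simpl;
  (split; [apply elementary_continuous; assumption |]).
- exact I.
- destruct (elementary_d1 D f hD hf) as [e1 x1].
  destruct (elementary_d2 D f hD hf) as [e2 x2].
  split; [intros r t h; split |]; auto.
Qed.

(** * Real powers as elementary expressions, and smoothness of Bour's surface *)

Lemma elementary_pow (D : R * R -> Prop) (f : R -> R -> R) (n : nat) :
  elementary D f -> elementary D (fun r t => f r t ^ n).
Proof.
intros hf; induction n as [| n IH]; simpl; [constructor |].
apply (el_mult D f (fun r t => f r t ^ n)); assumption.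
Qed.

(** The only candidate is [Int_part a]: since [up (IZR k)] is [k + 1], the integer part of [IZR k]
    is [k]. *)
Lemma Z_of_real_dec (a : R) : (exists k : Z, a = IZR k) \/ forall k : Z, a <> IZR k.
Proof.
destruct (Req_dec a (IZR (Int_part a))) as [h | h].
- left; eexists; exact h.
- right; intros k hk; apply h; rewrite hk at 2.
  unfold Int_part; rewrite <- (tech_up (IZR k) (k + 1)).
  + rewrite hk; f_equal; ring.
  + rewrite plus_IZR; lra.
  + rewrite plus_IZR; lra.
Qed.

Lemma pow_defined_IZR (x : R) (k : Z) :
  pow_defined x (IZR k) -> x <> 0 \/ (0 < k)%Z.
Proof.
intros [h | [j [e h]]]; [left; lra |].
apply eq_IZR in e; subst j; exact h.
Qed.

(** For an integer exponent this is a product or the inverse of one, and [pow_defined] keeps the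
    base nonzero in the second case. For any other exponent [pow_defined] forces a positive base on
    all of [D], so a single branch of [rpow] is met. *)
Lemma elementary_rpow (D : R * R -> Prop) (f : R -> R -> R) (a : R) :
  (forall r t, D (r, t) -> pow_defined (f r t) a) ->
  elementary D f -> elementary D (fun r t => rpow (f r t) a).
Proof.
intros hd hf; destruct (Z_of_real_dec a) as [[k ->] | hk].
- apply (el_ext _ (fun r t => powerRZ (f r t) k)).
  { intros; symmetry; apply rpow_IZR. }
  destruct k as [| p | p]; simpl.
  + constructor.
  + apply elementary_pow; exact hf.
  + apply (el_inv D (fun r t => f r t ^ Pos.to_nat p)).
    * intros r t h; apply pow_nonzero.
      destruct (pow_defined_IZR _ _ (hd r t h)) as [? | ?]; [assumption | lia].
    * apply elementary_pow; exact hf.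
- assert (h0 : forall r t, D (r, t) -> 0 < f r t).
  { intros r t h; destruct (hd r t h) as [? | [k [e _]]]; [assumption |].
    destruct (hk k e). }
  apply (el_ext _ (fun r t => Rpower (f r t) a)); [| constructor; assumption].
  intros r t h; unfold rpow.
  destruct (Rlt_dec 0 (f r t)) as [? | n]; [reflexivity |].
  destruct n; auto.
Qed.

Lemma bour_smooth (D : R * R -> Prop) (m : R) :
  open D -> (forall r t, D (r, t) -> bour_defined m r t) ->
  smooth_map D (bour m).
Proof.
intros hD hd.
assert (hr : forall a, a = m - 1 \/ a = m \/ a = m + 1 ->
  elementary D (fun r t => rpow r a)).
{ intros a ha; apply (elementary_rpow D (fun r _ => r)); [| constructor].
  intros r t h; apply (hd r t h); auto. }
assert (hc : forall a, a = m - 1 \/ a = m \/ a = m + 1 ->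
  elementary D (fun r t => rpow (cos t) a)).
{ intros a ha; apply (elementary_rpow D (fun _ t => cos t)); [| constructor].
  intros r t h; apply (hd r t h); auto. }
assert (hs : forall a, a = m - 1 \/ a = m \/ a = m + 1 ->
  elementary D (fun r t => rpow (sin t) a)).
{ intros a ha; apply (elementary_rpow D (fun _ t => sin t)); [| constructor].
  intros r t h; apply (hd r t h); auto. }
(* Every coordinate is one such term or a sum of two; [k] and [l] absorb the signs and the
   denominators. *)
assert (term : forall k l a, a = m - 1 \/ a = m \/ a = m + 1 ->
  elementary D (fun r t => rpow r a *
    (k * rpow (cos t) a + l * rpow (sin t) a))).
{ intros k l a ha; repeat (constructor; auto). }
split; [| split]; apply (elementary_smooth _ _ hD).
- eapply el_ext; [| apply el_plus;
    [apply (term (- / (m - 1)) (/ (m - 1)) (m - 1)); auto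
    |apply (term (- / (m + 1)) (/ (m + 1)) (m + 1)); auto]].
  intros r t _; unfold bour, mkL3, cx, Rdiv; simpl; ring.
- eapply el_ext; [| apply el_plus;
    [apply (term (/ (m - 1)) (/ (m - 1)) (m - 1)); auto
    |apply (term (- / (m + 1)) (- / (m + 1)) (m + 1)); auto]].
  intros r t _; unfold bour, mkL3, cy, Rdiv; simpl; ring.
- eapply el_ext; [| apply (term (2 * / m) (2 * / m) m); auto].
  intros r t _; unfold bour, mkL3, cz, Rdiv; simpl; ring.
Qed.

(** * Simple connectivity of convex sets, and the quadrant *)

Lemma convex_simply_connected (D : R * R -> Prop) :
  (forall p q s, D p -> D q -> 0 <= s <= 1 ->
     D ((1 - s) * fst p + s * fst q, (1 - s) * snd p + s * snd q)) ->
  simply_connected D.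
Proof.
intros hconv.
assert (line : forall (T : UniformSpace) (s a b : T -> R) (x : T),
  continuous s x -> continuous a x -> continuous b x ->
  continuous (fun y => (1 - s y) * a y + s y * b y) x).
{ intros T s a b x hs ha hb.
  apply (continuous_plus (V := R_NormedModule) (fun y => (1 - s y) * a y)).
  - apply (continuous_mult (K := R_AbsRing) (fun y => 1 - s y) a); [| exact ha].
    apply (continuous_minus (V := R_NormedModule) (fun _ => 1) s);
      [apply continuous_const | exact hs].
  - apply (continuous_mult (K := R_AbsRing) s b); assumption. }
assert (pair : forall (T : UniformSpace) (f g : T -> R) (x : T),
  continuous f x -> continuous g x -> continuous (fun y => (f y, g y)) x).
{ intros T f g x hf hg P [eps hP]; unfold filtermap.
  apply (filter_imp (fun y => ball (f x) eps (f y) /\ ball (g x) eps (g y))).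
  - intros y [h1 h2]; apply hP; split; assumption.
  - apply filter_and; [apply (hf (ball (f x) eps)) | apply (hg (ball (g x) eps))];
      apply locally_ball. }
split.
- intros p q hp hq.
  exists (fun s => ((1 - s) * fst p + s * fst q, (1 - s) * snd p + s * snd q)).
  split; [| split; [| split]].
  + intros s; apply pair; apply (line R_UniformSpace (fun y => y));
      try apply continuous_id; apply continuous_const.
  + intros s hs; apply hconv; assumption.
  + destruct p; simpl; f_equal; ring.
  + destruct q; simpl; f_equal; ring.
- intros c hc hD hloop.
  (* The straight-line homotopy contracts the loop to its base point [c 0]; the base point stays
     fixed at both ends because [c 1 = c 0]. *)
  exists (fun st => ((1 - fst st) * fst (c (snd st)) + fst st * fst (c 0),
                     (1 - fst st) * snd (c (snd st)) + fst st * snd (c 0))).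
  assert (hc2 : forall st : R * R, continuous (fun st => c (snd st)) st).
  { intros st; apply (continuous_comp snd c); [apply continuous_snd | apply hc]. }
  split; [| split; [| split]].
  + intros st; apply pair; apply (line (prod_UniformSpace R_UniformSpace R_UniformSpace) fst);
      try apply continuous_fst; try apply continuous_const.
    * apply (continuous_comp (fun st : R * R => c (snd st)) fst);
        [apply hc2 | apply continuous_fst].
    * apply (continuous_comp (fun st : R * R => c (snd st)) snd);
        [apply hc2 | apply continuous_snd].
  + intros s t hs ht; apply hconv; [apply hD | apply hD |]; simpl; lra.
  + intros t ht; simpl; split.
    * destruct (c t); simpl; f_equal; ring.
    * destruct (c 0); simpl; f_equal; ring.
  + intros s hs; simpl; rewrite <- hloop; split; destruct (c 0); simpl; f_equal; ring.
Qed.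

Lemma quadrant_open : open bour_quadrant.
Proof.
intros [r t] [h1 [h2 h3]]; simpl in *.
(* The distance to the nearest of the three sides; balls of the product are squares, so each
   coordinate can be checked separately. *)
set (e := Rmin r (Rmin t (PI / 2 - t))).
assert (he : 0 < e) by (unfold e; repeat apply Rmin_glb_lt; lra).
exists (mkposreal e he); intros [r' t'] [hr ht]; simpl in *.
unfold ball, AbsRing_ball, abs, minus, plus, opp in hr, ht; simpl in hr, ht.
unfold AbsRing_ball, abs, minus, plus, opp in hr, ht; simpl in hr, ht.
apply Rabs_def2 in hr; apply Rabs_def2 in ht.
assert (e <= r) by apply Rmin_l.
assert (e <= Rmin t (PI / 2 - t)) by apply Rmin_r.
assert (Rmin t (PI / 2 - t) <= t) by apply Rmin_l.
assert (Rmin t (PI / 2 - t) <= PI / 2 - t) by apply Rmin_r.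
unfold bour_quadrant; simpl; lra.
Qed.

Lemma quadrant_simply_connected : simply_connected bour_quadrant.
Proof.
apply convex_simply_connected.
intros [r t] [r' t'] s [h1 [h2 h3]] [k1 [k2 k3]] hs; unfold bour_quadrant; simpl in *.
assert (mean : forall x y, 0 < x -> 0 < y -> 0 < (1 - s) * x + s * y).
{ intros x y hx hy; destruct (Rle_lt_dec s (1 / 2)); nra. }
split; [auto | split; [auto |]].
(* The upper bound on the angle is the positivity of the interpolated complementary angle. *)
generalize (mean (PI / 2 - t) (PI / 2 - t') ltac:(lra) ltac:(lra)); lra.
Qed.

(** The combination [b1 * a - a1 * b] has no time component and is again null, by bilinearity; its
    spatial part has square length 0, so it vanishes. If [a1 = 0], the same argument makes [a]
    itself zero. *)
Lemma null_orthogonal_dependent (a b : L3) :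
  mink a a = 0 -> mink b b = 0 -> mink a b = 0 ->
  exists p q : R, (p <> 0 \/ q <> 0) /\
    addL3 (scaleL3 p a) (scaleL3 q b) = mkL3 0 0 0.
Proof.
destruct a as [[a1 a2] a3], b as [[b1 b2] b3].
unfold mink, addL3, scaleL3, mkL3, cx, cy, cz; simpl; intros ha hb hab.
assert (sq : (b1 * a2 - a1 * b2) ^ 2 + (b1 * a3 - a1 * b3) ^ 2 = 0).
{ replace ((b1 * a2 - a1 * b2) ^ 2 + (b1 * a3 - a1 * b3) ^ 2) with
    (b1 ^ 2 * (- (a1 * a1) + a2 * a2 + a3 * a3)
     - 2 * a1 * b1 * (- (a1 * b1) + a2 * b2 + a3 * b3)
     + a1 ^ 2 * (- (b1 * b1) + b2 * b2 + b3 * b3)) by ring.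
  rewrite ha, hb, hab; ring. }
assert (sum0 : forall x y : R, x ^ 2 + y ^ 2 = 0 -> x = 0 /\ y = 0).
{ intros x y h; split; nra. }
destruct (sum0 _ _ sq) as [e2 e3].
destruct (Req_dec a1 0) as [z | nz]; [| exists b1, (- a1)].
- exists 1, 0; split; [lra |].
  destruct (sum0 a2 a3) as [-> ->]; [subst; lra | subst].
  repeat f_equal; ring.
- split; [right; lra |]; repeat f_equal; lra.
Qed.

(** * Partial derivatives of a function of [r cos t] plus a function of [r sin t] *)

Section sum_of_curves.

Variables (D : R * R -> Prop) (f : R -> R -> R) (a a1 b b1 : R -> R).
Hypothesis D_open : open D.
Hypothesis f_sum :
  forall r t, D (r, t) -> f r t = a (r * cos t) + b (r * sin t).
Hypothesis a_diff : forall r t, D (r, t) -> is_derive a (r * cos t) (a1 (r * cos t)).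
Hypothesis b_diff : forall r t, D (r, t) -> is_derive b (r * sin t) (b1 (r * sin t)).
Hypothesis a1_diff : forall r t, D (r, t) -> ex_derive a1 (r * cos t).
Hypothesis b1_diff : forall r t, D (r, t) -> ex_derive b1 (r * sin t).

Lemma d1_sum (r t : R) : D (r, t) ->
  d1 f r t = cos t * a1 (r * cos t) + sin t * b1 (r * sin t).
Proof.
intros h; rewrite (d1_ext_open D _ _ _ _ D_open f_sum h); apply is_derive_unique.
auto_derive.
- repeat split; [exists (a1 (r * cos t)) | exists (b1 (r * sin t))]; auto.
- change (fun x => a x) with a; change (fun x => b x) with b.
  rewrite (is_derive_unique _ _ _ (a_diff r t h)).
  rewrite (is_derive_unique _ _ _ (b_diff r t h)); ring.
Qed.

Lemma d2_sum (r t : R) : D (r, t) ->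
  d2 f r t = - (r * sin t) * a1 (r * cos t) + r * cos t * b1 (r * sin t).
Proof.
intros h; rewrite (d2_ext_open D _ _ _ _ D_open f_sum h); apply is_derive_unique.
auto_derive.
- repeat split; [exists (a1 (r * cos t)) | exists (b1 (r * sin t))]; auto.
- change (fun x => a x) with a; change (fun x => b x) with b.
  rewrite (is_derive_unique _ _ _ (a_diff r t h)).
  rewrite (is_derive_unique _ _ _ (b_diff r t h)); ring.
Qed.

Lemma d1_d1_sum (r t : R) : D (r, t) ->
  d1 (d1 f) r t = cos t ^ 2 * Derive a1 (r * cos t) + sin t ^ 2 * Derive b1 (r * sin t).
Proof.
intros h; rewrite (d1_ext_open D _ _ _ _ D_open d1_sum h); apply is_derive_unique.
auto_derive; [repeat split; eauto |].
change (fun x => a1 x) with a1; change (fun x => b1 x) with b1; ring.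
Qed.

Lemma d2_d1_sum (r t : R) : D (r, t) ->
  d2 (d1 f) r t =
    - sin t * a1 (r * cos t) + cos t * b1 (r * sin t)
    + r * cos t * sin t * (Derive b1 (r * sin t) - Derive a1 (r * cos t)).
Proof.
intros h; rewrite (d2_ext_open D _ _ _ _ D_open d1_sum h); apply is_derive_unique.
auto_derive; [repeat split; eauto |].
change (fun x => a1 x) with a1; change (fun x => b1 x) with b1; ring.
Qed.

(** The first line equals [- r * d1 f r t], because the second [t]-derivative of
    [(r cos t, r sin t)] is its opposite. It is tangential and will vanish against the normal. *)
Lemma d2_d2_sum (r t : R) : D (r, t) ->
  d2 (d2 f) r t =
    - r * (cos t * a1 (r * cos t) + sin t * b1 (r * sin t))
    + r ^ 2 * (sin t ^ 2 * Derive a1 (r * cos t) + cos t ^ 2 * Derive b1 (r * sin t)).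
Proof.
intros h; rewrite (d2_ext_open D _ _ _ _ D_open d2_sum h); apply is_derive_unique.
auto_derive; [repeat split; eauto |].
change (fun x => a1 x) with a1; change (fun x => b1 x) with b1; ring.
Qed.

End sum_of_curves.

(* [a] and [b] are the velocities of the two null curves, [a'] and [b'] their
   accelerations. *)
Lemma null_frame_mean_curvature (a b a' b' e : L3) (r c s : R) :
  mink a a = 0 -> mink b b = 0 -> mink a e = 0 -> mink b e = 0 ->
  let xr := addL3 (scaleL3 c a) (scaleL3 s b) in
  let xt := addL3 (scaleL3 (- (r * s)) a) (scaleL3 (r * c) b) in
  let xrr := addL3 (scaleL3 (c ^ 2) a') (scaleL3 (s ^ 2) b') in
  let xrt := addL3 (addL3 (scaleL3 (- s) a) (scaleL3 c b))
                   (scaleL3 (r * c * s) (addL3 b' (scaleL3 (-1) a'))) in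
  let xtt := addL3 (scaleL3 (- r) xr)
                   (scaleL3 (r ^ 2) (addL3 (scaleL3 (s ^ 2) a') (scaleL3 (c ^ 2) b'))) in
  mink xr xr * mink xtt e - 2 * mink xr xt * mink xrt e + mink xt xt * mink xrr e = 0.
Proof.
intros ha hb hae hbe xr xt xrr xrt xtt.
set (p := mink a b); set (x := mink a' e); set (y := mink b' e).
assert (hE : mink xr xr = c ^ 2 * mink a a + 2 * c * s * p + s ^ 2 * mink b b).
{ unfold xr, p, mink, addL3, scaleL3, mkL3, cx, cy, cz; simpl; ring. }
assert (hF : mink xr xt =
  - (r * s * c) * mink a a + r * (c ^ 2 - s ^ 2) * p + r * c * s * mink b b).
{ unfold xr, xt, p, mink, addL3, scaleL3, mkL3, cx, cy, cz; simpl; ring. }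
assert (hG : mink xt xt =
  r ^ 2 * (s ^ 2 * mink a a - 2 * c * s * p + c ^ 2 * mink b b)).
{ unfold xt, p, mink, addL3, scaleL3, mkL3, cx, cy, cz; simpl; ring. }
assert (hL : mink xrr e = c ^ 2 * x + s ^ 2 * y).
{ unfold xrr, x, y, mink, addL3, scaleL3, mkL3, cx, cy, cz; simpl; ring. }
assert (hM : mink xrt e =
  - s * mink a e + c * mink b e + r * c * s * (y - x)).
{ unfold xrt, x, y, mink, addL3, scaleL3, mkL3, cx, cy, cz; simpl; ring. }
assert (hN : mink xtt e = - r * (c * mink a e + s * mink b e)
  + r ^ 2 * (s ^ 2 * x + c ^ 2 * y)).
{ unfold xtt, xr, x, y, mink, addL3, scaleL3, mkL3, cx, cy, cz; simpl; ring. }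
(* What remains is [2 * r^2 * c * s * p] times a combination of [x] and [y] whose two coefficients
   cancel. *)
rewrite hE, hF, hG, hL, hM, hN, ha, hb, hae, hbe; ring.
Qed.

(** * Sums of two null curves: tangent frame, mean curvature and signature *)

Ltac unfold_L3 :=
  unfold mink, crossL3, addL3, scaleL3, mkL3, cx, cy, cz in *; simpl in *.

Definition velocity (a : R -> L3) (v : L3) (u : R) : Prop :=
  is_derive (fun x => cx (a x)) u (cx v) /\
  is_derive (fun x => cy (a x)) u (cy v) /\
  is_derive (fun x => cz (a x)) u (cz v).

Definition ex_velocity (a : R -> L3) (u : R) : Prop :=
  ex_derive (fun x => cx (a x)) u /\
  ex_derive (fun x => cy (a x)) u /\
  ex_derive (fun x => cz (a x)) u.

Definition DeriveL3 (a : R -> L3) (u : R) : L3 :=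
  mkL3 (Derive (fun x => cx (a x)) u)
       (Derive (fun x => cy (a x)) u)
       (Derive (fun x => cz (a x)) u).

Section sum_of_null_curves.

Variables (D : R * R -> Prop) (X : R -> R -> L3) (a a1 b b1 : R -> L3).
Hypothesis D_open : open D.
Hypothesis X_sum :
  forall r t, D (r, t) -> X r t = addL3 (a (r * cos t)) (b (r * sin t)).
Hypothesis a_diff : forall r t, D (r, t) -> velocity a (a1 (r * cos t)) (r * cos t).
Hypothesis b_diff : forall r t, D (r, t) -> velocity b (b1 (r * sin t)) (r * sin t).
Hypothesis a1_diff : forall r t, D (r, t) -> ex_velocity a1 (r * cos t).
Hypothesis b1_diff : forall r t, D (r, t) -> ex_velocity b1 (r * sin t).
Hypothesis a1_null :
  forall r t, D (r, t) -> mink (a1 (r * cos t)) (a1 (r * cos t)) = 0.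
Hypothesis b1_null :
  forall r t, D (r, t) -> mink (b1 (r * sin t)) (b1 (r * sin t)) = 0.

Let sum_coord (p : L3 -> R)
  (p_add : forall v w, p (addL3 v w) = p v + p w) r t (h : D (r, t)) :
  p (X r t) = p (a (r * cos t)) + p (b (r * sin t)).
Proof. rewrite X_sum; auto. Qed.

(** Lifts a scalar formula of the previous section to the three coordinates and discharges its
    hypotheses. *)
Ltac coords lem :=
  unfold mkL3; f_equal; [f_equal |];
  [ apply (lem D _ (fun x => cx (a x)) (fun x => cx (a1 x))
             (fun x => cx (b x)) (fun x => cx (b1 x)))
  | apply (lem D _ (fun x => cy (a x)) (fun x => cy (a1 x))
             (fun x => cy (b x)) (fun x => cy (b1 x)))
  | apply (lem D _ (fun x => cz (a x)) (fun x => cz (a1 x))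
             (fun x => cz (b x)) (fun x => cz (b1 x))) ];
  try assumption;
  try (intros r' t' h'; apply sum_coord; [reflexivity | exact h']);
  try (intros r' t' h'; apply (a_diff r' t' h'));
  try (intros r' t' h'; apply (b_diff r' t' h'));
  try (intros r' t' h'; apply (a1_diff r' t' h'));
  try (intros r' t' h'; apply (b1_diff r' t' h')).

Lemma dr_sum (r t : R) : D (r, t) ->
  dr X r t = addL3 (scaleL3 (cos t) (a1 (r * cos t))) (scaleL3 (sin t) (b1 (r * sin t))).
Proof. intros h; unfold dr, addL3, scaleL3; coords d1_sum. Qed.

Lemma dt_sum (r t : R) : D (r, t) ->
  dt X r t = addL3 (scaleL3 (- (r * sin t)) (a1 (r * cos t)))
                   (scaleL3 (r * cos t) (b1 (r * sin t))).
Proof. intros h; unfold dt, addL3, scaleL3; coords d2_sum. Qed.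

Lemma dr_dr_sum (r t : R) : D (r, t) ->
  dr (dr X) r t = addL3 (scaleL3 (cos t ^ 2) (DeriveL3 a1 (r * cos t)))
                        (scaleL3 (sin t ^ 2) (DeriveL3 b1 (r * sin t))).
Proof. intros h; unfold dr, addL3, scaleL3; coords d1_d1_sum. Qed.

Lemma dt_dr_sum (r t : R) : D (r, t) ->
  dt (dr X) r t =
  addL3 (addL3 (scaleL3 (- sin t) (a1 (r * cos t))) (scaleL3 (cos t) (b1 (r * sin t))))
        (scaleL3 (r * cos t * sin t)
           (addL3 (DeriveL3 b1 (r * sin t)) (scaleL3 (-1) (DeriveL3 a1 (r * cos t))))).
Proof.
intros h.
(* Brings the vector formula to the difference of derivatives that [d2_d1_sum] produces. *)
assert (sub : forall v w, addL3 v (scaleL3 (-1) w) =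
  mkL3 (cx v - cx w) (cy v - cy w) (cz v - cz w)).
{ intros v w; unfold_L3; f_equal; [f_equal |]; ring. }
rewrite sub; unfold dt, dr, addL3, scaleL3; coords d2_d1_sum.
Qed.

Lemma dt_dt_sum (r t : R) : D (r, t) ->
  dt (dt X) r t =
  addL3 (scaleL3 (- r) (addL3 (scaleL3 (cos t) (a1 (r * cos t)))
                              (scaleL3 (sin t) (b1 (r * sin t)))))
        (scaleL3 (r ^ 2) (addL3 (scaleL3 (sin t ^ 2) (DeriveL3 a1 (r * cos t)))
                                (scaleL3 (cos t ^ 2) (DeriveL3 b1 (r * sin t))))).
Proof. intros h; unfold dt, addL3, scaleL3; coords d2_d2_sum. Qed.

(** The cross product of two combinations of [a1] and [b1] is a multiple of that of [a1] and [b1],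
    hence orthogonal to both; normalisation only rescales it. *)
Lemma unit_normal_sum (r t : R) : D (r, t) ->
  mink (a1 (r * cos t)) (unit_normal X r t) = 0 /\
  mink (b1 (r * sin t)) (unit_normal X r t) = 0.
Proof.
intros h; unfold unit_normal; rewrite dr_sum, dt_sum by exact h.
set (k := / sqrt _); clearbody k.
generalize (a1 (r * cos t)) (b1 (r * sin t)); intros [[x y] z] [[x' y'] z'].
unfold_L3; split; ring.
Qed.

Lemma mean_curvature_sum (r t : R) : D (r, t) -> mean_curvature X r t = 0.
Proof.
intros h; destruct (unit_normal_sum r t h) as [hae hbe].
unfold mean_curvature, coefL, coefM, coefN, coefE, coefF, coefG at 1.
rewrite dr_dr_sum, dt_dr_sum, dt_dt_sum by exact h.
rewrite (dr_sum r t h), (dt_sum r t h).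
rewrite null_frame_mean_curvature; auto; unfold Rdiv; ring.
Qed.

(** The parameter vector is the one with [du = k] and [dv = l], obtained by inverting the Jacobian
    of [(r cos t, r sin t)]. *)
Lemma differential_sum (r t k l : R) : D (r, t) -> r <> 0 ->
  differential X r t (k * cos t + l * sin t, (l * cos t - k * sin t) / r) =
  addL3 (scaleL3 k (a1 (r * cos t))) (scaleL3 l (b1 (r * sin t))).
Proof.
intros h hr; unfold differential; rewrite dr_sum, dt_sum by exact h.
generalize (sin2_cos2 t); unfold Rsqr; intros cs.
generalize (a1 (r * cos t)) (b1 (r * sin t)); intros [[x y] z] [[x' y'] z'].
assert (e : forall p q,
  (k * cos t + l * sin t) * (cos t * p + sin t * q) +
  (l * cos t - k * sin t) / r * (- (r * sin t) * p + r * cos t * q) = k * p + l * q).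
{ intros p q.
  replace (k * p + l * q) with ((sin t * sin t + cos t * cos t) * (k * p + l * q))
    by (rewrite cs; ring).
  field; exact hr. }
unfold_L3; f_equal; [f_equal |]; apply e.
Qed.

(** At [r = 0] the [t]-derivative vanishes, and orthogonal null velocities are dependent; either
    case puts a nonzero vector in the kernel of the differential. *)
Lemma immersion_sum (r t : R) : D (r, t) -> immersion_at X r t ->
  r <> 0 /\ mink (a1 (r * cos t)) (b1 (r * sin t)) <> 0.
Proof.
intros h him.
assert (hr : r <> 0).
{ intros hr.
  assert (e : (0, 1) = (0, 0)); [apply him | injection e; lra].
  unfold differential; rewrite dr_sum, dt_sum by exact h.
  rewrite hr; unfold_L3; f_equal; [f_equal |]; ring. }
split; [exact hr |]; intros hab.
destruct (null_orthogonal_dependent _ _ (a1_null r t h) (b1_null r t h) hab)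
  as [k [l [kl e]]].
(* The dependence relation becomes a kernel vector; undoing the rotation by [t] then gives
   [k = l = 0], a contradiction. *)
rewrite <- (differential_sum r t k l h hr) in e; apply him in e.
injection e; intros e2 e1.
assert (e3 : l * cos t - k * sin t = 0).
{ replace (l * cos t - k * sin t) with ((l * cos t - k * sin t) / r * r) by (field; exact hr).
  rewrite e2; ring. }
generalize (sin2_cos2 t); unfold Rsqr; intros cs.
assert (k = 0).
{ replace k with ((sin t * sin t + cos t * cos t) * k) by (rewrite cs; ring).
  replace ((sin t * sin t + cos t * cos t) * k) with
    (cos t * (k * cos t + l * sin t) - sin t * (l * cos t - k * sin t)) by ring.
  rewrite e1, e3; ring. }
assert (l = 0).
{ replace l with ((sin t * sin t + cos t * cos t) * l) by (rewrite cs; ring).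
  replace ((sin t * sin t + cos t * cos t) * l) with
    (sin t * (k * cos t + l * sin t) + cos t * (l * cos t - k * sin t)) by ring.
  rewrite e1, e3; ring. }
tauto.
Qed.

(** Pairing a relation between the null velocities with one of them isolates the coefficient of the
    other, times their nonzero product. *)
Lemma sum_immersion (r t : R) : D (r, t) -> r <> 0 ->
  mink (a1 (r * cos t)) (b1 (r * sin t)) <> 0 -> immersion_at X r t.
Proof.
intros h hr hab [x y] e.
generalize (sin2_cos2 t); unfold Rsqr; intros cs.
set (k := x * cos t - y * r * sin t); set (l := x * sin t + y * r * cos t).
assert (ex : x = k * cos t + l * sin t).
{ unfold k, l; replace x with ((sin t * sin t + cos t * cos t) * x) at 1
    by (rewrite cs; ring); ring. }
assert (ey : y = (l * cos t - k * sin t) / r).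
{ unfold k, l; replace y with ((sin t * sin t + cos t * cos t) * y) at 1
    by (rewrite cs; ring); field; exact hr. }
clearbody k l; subst x y; rewrite (differential_sum r t k l h hr) in e.
generalize (a1_null r t h) (b1_null r t h) hab; intros ha hb hp.
assert (hk : k * mink (a1 (r * cos t)) (b1 (r * sin t)) = 0).
{ replace (k * _) with (mink (addL3 (scaleL3 k (a1 (r * cos t)))
     (scaleL3 l (b1 (r * sin t)))) (b1 (r * sin t))
     - l * mink (b1 (r * sin t)) (b1 (r * sin t))) by (unfold_L3; ring).
  rewrite e, hb; unfold_L3; ring. }
assert (hl : l * mink (a1 (r * cos t)) (b1 (r * sin t)) = 0).
{ replace (l * _) with (mink (addL3 (scaleL3 k (a1 (r * cos t)))
     (scaleL3 l (b1 (r * sin t)))) (a1 (r * cos t))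
     - k * mink (a1 (r * cos t)) (a1 (r * cos t))) by (unfold_L3; ring).
  rewrite e, ha; unfold_L3; ring. }
apply Rmult_integral in hk, hl.
destruct hk as [-> | ?], hl as [-> | ?]; try tauto.
f_equal; field; exact hr.
Qed.

Lemma lorentzian_sum (r t : R) : D (r, t) -> immersion_at X r t ->
  lorentzian (induced_metric X r t).
Proof.
intros h him; destruct (immersion_sum r t h him) as [hr hp].
assert (g : forall k l k' l',
  induced_metric X r t
    (k * cos t + l * sin t, (l * cos t - k * sin t) / r)
    (k' * cos t + l' * sin t, (l' * cos t - k' * sin t) / r) =
  (k * l' + l * k') * mink (a1 (r * cos t)) (b1 (r * sin t))).
{ intros k l k' l'; unfold induced_metric; rewrite !differential_sum by assumption.
  match goal with |- ?lhs = ?rhs =>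
    replace lhs with (k * k' * mink (a1 (r * cos t)) (a1 (r * cos t)) + rhs
      + l * l' * mink (b1 (r * sin t)) (b1 (r * sin t))) by (unfold_L3; ring)
  end.
  rewrite (a1_null r t h), (b1_null r t h); ring. }
set (p := mink _ _) in *.
(* In the null frame the metric sends [(k, l)] to [2 * k * l * p], so the components
   [(1, - / (2 * p))] and [(1, / (2 * p))] give an orthonormal basis. *)
eexists (_, _), (_, _); split; [| split].
- rewrite (g 1 (- / (2 * p)) 1 (- / (2 * p))); field; exact hp.
- rewrite (g 1 (/ (2 * p)) 1 (/ (2 * p))); field; exact hp.
- rewrite (g 1 (- / (2 * p)) 1 (/ (2 * p))); field; exact hp.
Qed.

End sum_of_null_curves.

(** * Derivatives and algebra of real powers *)

Lemma is_derive_powerRZ (x : R) (k : Z) : x <> 0 \/ (0 <= k)%Z ->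
  is_derive (fun y => powerRZ y k) x (IZR k * powerRZ x (k - 1)).
Proof.
assert (pow_case : forall n : nat,
  is_derive (fun y => y ^ n) x (INR n * 1 * x ^ Init.Nat.pred n)).
{ intros n; apply (is_derive_pow (fun y => y)), (is_derive_id (K := R_AbsRing)). }
intros h; destruct (Z_le_gt_dec 0 k) as [hk | hk].
- destruct (Z_of_nat_complete _ hk) as [n ->]; rewrite <- INR_IZR_INZ.
  apply (is_derive_ext (fun y => y ^ n)).
  { intros y; apply pow_powerRZ. }
  replace (INR n * powerRZ x (Z.of_nat n - 1)) with (INR n * 1 * x ^ Init.Nat.pred n);
    [apply pow_case |].
  (* For exponent 0 the factor [INR 0] cancels [powerRZ x (-1)], even at [x = 0]. *)
  destruct n as [| n]; [simpl; ring |].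
  rewrite (pow_powerRZ x); simpl Init.Nat.pred.
  replace (Z.of_nat (S n) - 1)%Z with (Z.of_nat n) by lia; ring.
- assert (hx : x <> 0) by (destruct h; [assumption | lia]).
  set (n := Z.to_nat (- k)).
  assert (inv : forall y, / y ^ n = powerRZ y k).
  { intros y; rewrite pow_powerRZ, <- powerRZ_neg'; f_equal; lia. }
  apply (is_derive_ext _ _ _ _ inv).
  replace (IZR k * powerRZ x (k - 1)) with
    (- (INR n * 1 * x ^ Init.Nat.pred n) / (x ^ n) ^ 2).
  + apply is_derive_inv; [apply pow_case | apply pow_nonzero; exact hx].
  + replace (k - 1)%Z with (k + - (1))%Z by lia.
    rewrite powerRZ_add, <- inv by exact hx.
    replace (IZR k) with (- INR n) by (rewrite INR_IZR_INZ, <- opp_IZR; f_equal; lia).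
    assert (hn : x ^ n = x * x ^ Init.Nat.pred n).
    { change (x ^ n = x ^ S (Init.Nat.pred n)); f_equal; lia. }
    rewrite hn; change (powerRZ x (- (1))) with (/ (x * 1)).
    assert (x ^ Init.Nat.pred n <> 0) by (apply pow_nonzero; exact hx).
    field; auto.
Qed.

(** Near a positive base [rpow] is [Rpower]; otherwise the exponent is an integer and [rpow] is
    [powerRZ] everywhere. The case [a = 0] serves the exponent [m - 2] at [m = 2], where the base
    may be 0. *)
Lemma is_derive_rpow (x a : R) : pow_defined x a \/ a = 0 ->
  is_derive (fun y => rpow y a) x (a * rpow x (a - 1)).
Proof.
intros hd; destruct (Rlt_dec 0 x) as [hx | hx].
- replace (rpow x (a - 1)) with (Rpower x (a - 1))
    by (unfold rpow; destruct (Rlt_dec 0 x); [reflexivity | tauto]).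
  apply (is_derive_ext_loc (fun y => Rpower y a)); [| apply is_derive_Rpower, hx].
  eapply filter_imp; [| exact (open_gt 0 x hx)]; intros y hy; unfold rpow.
  destruct (Rlt_dec 0 y); [reflexivity | tauto].
- assert (hk : exists k : Z, a = IZR k /\ (x <> 0 \/ (0 <= k)%Z)).
  { destruct hd as [[? | [k [e h]]] | e]; [tauto | |].
    - exists k; split; [exact e | destruct h; [tauto | right; lia]].
    - exists 0%Z; split; [exact e | right; lia]. }
  destruct hk as [k [-> hk]]; rewrite <- minus_IZR, rpow_IZR.
  apply (is_derive_ext (fun y => powerRZ y k)).
  { intros y; symmetry; apply rpow_IZR. }
  apply is_derive_powerRZ; exact hk.
Qed.

Lemma rpow_pos (x a : R) : 0 < x -> rpow x a = Rpower x a.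
Proof. unfold rpow; destruct (Rlt_dec 0 x); [reflexivity | tauto]. Qed.

(** Merges the factors in [r] and in [cos t] or [sin t] into powers of [u] or [v]. Unless both bases
    are positive, the exponent is an integer. *)
Lemma rpow_mult (x y a : R) : pow_defined x a -> pow_defined y a ->
  rpow x a * rpow y a = rpow (x * y) a.
Proof.
intros hx hy.
assert (hint : forall k, a = IZR k -> rpow x a * rpow y a = rpow (x * y) a).
{ intros k ->; rewrite !rpow_IZR, powerRZ_mult; reflexivity. }
destruct hx as [hx | [k [e _]]]; [| eauto].
destruct hy as [hy | [k [e _]]]; [| eauto].
rewrite !rpow_pos by (auto using Rmult_lt_0_compat).
apply Rpower_mult_distr; assumption.
Qed.

Lemma pow_defined_mult (x y a : R) : pow_defined x a -> pow_defined y a ->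
  pow_defined (x * y) a.
Proof.
intros [hx | [k [-> hk]]] hy.
- destruct hy as [hy | [k [-> hk]]]; [left; apply Rmult_lt_0_compat; assumption |].
  right; exists k; split; [reflexivity |].
  destruct hk; [left; apply Rmult_integral_contrapositive_currified; lra | tauto].
- right; exists k; split; [reflexivity |].
  apply pow_defined_IZR in hy; destruct hk, hy; try tauto.
  left; apply Rmult_integral_contrapositive_currified; assumption.
Qed.

Lemma rpow_geometric (x a : R) : pow_defined x a ->
  rpow x (a - 1) * rpow x (a + 1) = rpow x a ^ 2.
Proof.
intros [hx | [k [-> hk]]].
- rewrite !rpow_pos by exact hx; rewrite <- Rpower_plus; simpl.
  rewrite Rmult_1_r, <- Rpower_plus; f_equal; ring.
- rewrite <- minus_IZR, <- plus_IZR, !rpow_IZR.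
  destruct (Req_dec x 0) as [-> | hx].
  (* At base 0 the power [k - 1] may be 1, when [k = 1]; the powers [k] and [k + 1] vanish, which is
     enough. *)
  + assert (0 < k)%Z by tauto.
    assert (z : forall j, (0 < j)%Z -> powerRZ 0 j = 0).
    { intros [| p | p] hj; try lia; simpl; apply pow_i; lia. }
    rewrite (z k), (z (k + 1)%Z) by lia; ring.
  + simpl; rewrite Rmult_1_r, <- !powerRZ_add by exact hx; f_equal; lia.
Qed.

(* Bour's surface is the sum of the null curve with [k = -1] at [r cos t] and the
   one with [k = 1] at [r sin t]. *)
Definition bour_curve (m k x : R) : L3 :=
  mkL3 (k * (rpow x (m - 1) / (m - 1) + rpow x (m + 1) / (m + 1)))
       (rpow x (m - 1) / (m - 1) - rpow x (m + 1) / (m + 1))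
       (2 * (rpow x m / m)).

(** For nonzero [x] this is [x^(m-2)] times [(k (1 + x^2), 1 - x^2, 2 x)], the rational
    parametrisation of the light cone when [k^2 = 1]. *)
Definition bour_velocity (m k x : R) : L3 :=
  mkL3 (k * (rpow x (m - 1 - 1) + rpow x m))
       (rpow x (m - 1 - 1) - rpow x m)
       (2 * rpow x (m - 1)).

(** * The two null curves of Bour's surface *)

Lemma bour_sum (m r t : R) : bour_defined m r t ->
  bour m r t = addL3 (bour_curve m (-1) (r * cos t)) (bour_curve m 1 (r * sin t)).
Proof.
intros hd; unfold bour, bour_curve.
rewrite <- !rpow_mult by (apply hd; auto).
unfold_L3; f_equal; [f_equal |]; unfold Rdiv; ring.
Qed.

Section bour_curve.

Variables (m k x : R).
Hypotheses (hm1 : m <> -1) (hm2 : m <> 0) (hm3 : m <> 1).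
Hypothesis hx : forall a, a = m - 1 \/ a = m \/ a = m + 1 -> pow_defined x a.

Lemma bour_curve_velocity : velocity (bour_curve m k) (bour_velocity m k x) x.
Proof.
(* The denominators cancel the exponents brought down; these are nonzero exactly because [m] avoids
   -1, 0 and 1. *)
assert (d : forall a b, a = m - 1 \/ a = m \/ a = m + 1 -> b = a - 1 -> a <> 0 ->
  is_derive (fun y => rpow y a / a) x (rpow x b)).
{ intros a b ha -> h0.
  replace (rpow x (a - 1)) with (/ a * (a * rpow x (a - 1))) by (field; exact h0).
  apply (is_derive_ext (fun y => / a * rpow y a)); [intros y; apply Rmult_comm |].
  apply (is_derive_scal (fun y => rpow y a)), is_derive_rpow; auto. }
assert (e1 := d (m - 1) (m - 1 - 1) ltac:(auto) eq_refl ltac:(lra)).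
assert (e2 := d (m + 1) m ltac:(auto) ltac:(ring) ltac:(lra)).
assert (e3 := d m (m - 1) ltac:(auto) eq_refl hm2).
split; [| split]; unfold bour_curve, bour_velocity, mkL3, cx, cy, cz; simpl.
- apply (is_derive_scal (fun y => _ + _)).
  apply (is_derive_plus (V := R_NormedModule)); assumption.
- apply (is_derive_minus (V := R_NormedModule)); assumption.
- apply (is_derive_scal (fun y => _)); assumption.
Qed.

Lemma bour_velocity_diff : ex_velocity (bour_velocity m k) x.
Proof.
(* The exponent [m - 2] is not covered by [hx]. If [m - 1] is an integer [j], then [j = 1] gives a
   constant power, and for [j <> 1] a positive [j] leaves [j - 1] positive. *)
assert (d0 : ex_derive (fun y => rpow y (m - 1 - 1)) x).
{ eexists; apply is_derive_rpow.
  destruct (hx (m - 1)) as [h | [j [e h]]]; [auto | left; left; exact h |].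
  destruct (Z.eq_dec j 1) as [-> | hj]; [right; lra | left; right].
  exists (j - 1)%Z; rewrite e, minus_IZR; split; [reflexivity |].
  destruct h; [tauto | right; lia]. }
assert (d : forall a, a = m - 1 \/ a = m \/ a = m + 1 ->
  ex_derive (fun y => rpow y a) x).
{ intros a ha; eexists; apply is_derive_rpow; auto. }
assert (e1 := d (m - 1) ltac:(auto)); assert (e2 := d m ltac:(auto)).
split; [| split]; unfold bour_velocity, mkL3, cx, cy, cz; simpl.
- apply (ex_derive_scal (fun y => _ + _)).
  apply (ex_derive_plus (V := R_NormedModule)); assumption.
- apply (ex_derive_minus (V := R_NormedModule)); assumption.
- apply (ex_derive_scal (fun y => _)); assumption.
Qed.

(** The squares cancel since [k^2 = 1]; the cross terms cancel against the third coordinate by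
    [rpow_geometric] at the exponent [m - 1]. *)
Lemma bour_velocity_null : k ^ 2 = 1 ->
  mink (bour_velocity m k x) (bour_velocity m k x) = 0.
Proof.
intros hk; generalize (rpow_geometric x (m - 1) (hx (m - 1) ltac:(auto))).
replace (m - 1 + 1) with m by ring; intros g.
unfold bour_velocity; unfold_L3.
match goal with |- ?lhs = 0 => replace lhs with
  ((1 - k ^ 2) * (rpow x (m - 1 - 1) ^ 2 + rpow x m ^ 2)
   - 2 * (k ^ 2 + 1) * (rpow x (m - 1 - 1) * rpow x m)
   + 4 * rpow x (m - 1) ^ 2) by ring end.
rewrite g; simpl; rewrite hk; ring.
Qed.

End bour_curve.

(** The opposite signs of [k] turn the time part positive, and the expansion has only positive
    terms. *)
Lemma bour_velocity_quadrant (m x y : R) : 0 < x -> 0 < y ->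
  0 < mink (bour_velocity m (-1) x) (bour_velocity m 1 y).
Proof.
intros hx hy.
assert (pos : forall z a, 0 < z -> 0 < rpow z a).
{ intros z a hz; rewrite rpow_pos by exact hz; apply exp_pos. }
unfold bour_velocity; unfold_L3.
match goal with |- 0 < ?lhs => replace lhs with
  (2 * (rpow x (m - 1 - 1) * rpow y (m - 1 - 1)) + 2 * (rpow x m * rpow y m)
   + 4 * (rpow x (m - 1) * rpow y (m - 1))) by ring end.
repeat apply Rplus_lt_0_compat; repeat apply Rmult_lt_0_compat; auto; lra.
Qed.

(** * Bour's surface on the quadrant and on general domains *)

Lemma bour_defined_cos_sin (m r t a : R) : bour_defined m r t ->
  a = m - 1 \/ a = m \/ a = m + 1 ->
  pow_defined (r * cos t) a /\ pow_defined (r * sin t) a.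
Proof. intros hd ha; split; apply pow_defined_mult; apply hd; auto. Qed.

(** The disjunction serves both halves of the theorem: immersion is assumed on a general domain, and
    on the quadrant it follows from the nonzero product of the null velocities. *)
Lemma bour_immersion_timelike_minimal (m : R) (D : R * R -> Prop) :
  m <> -1 -> m <> 0 -> m <> 1 -> open D -> simply_connected D ->
  (forall r t, D (r, t) -> bour_defined m r t) ->
  (forall r t, D (r, t) -> immersion_at (bour m) r t \/
     r <> 0 /\ mink (bour_velocity m (-1) (r * cos t))
                    (bour_velocity m 1 (r * sin t)) <> 0) ->
  timelike_minimal_surface D (bour m).
Proof.
intros hm1 hm2 hm3 hD hsc hd him.
assert (hs : forall r t, D (r, t) -> bour m r t =
  addL3 (bour_curve m (-1) (r * cos t)) (bour_curve m 1 (r * sin t))).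
{ intros r t h; apply bour_sum, hd, h. }
assert (hc : forall r t, D (r, t) -> forall a,
  a = m - 1 \/ a = m \/ a = m + 1 -> pow_defined (r * cos t) a).
{ intros r t h a ha; apply (bour_defined_cos_sin m); auto. }
assert (hv : forall r t, D (r, t) -> forall a,
  a = m - 1 \/ a = m \/ a = m + 1 -> pow_defined (r * sin t) a).
{ intros r t h a ha; apply (bour_defined_cos_sin m); auto. }
assert (va := fun r t h => bour_curve_velocity m (-1) _ hm1 hm2 hm3 (hc r t h)).
assert (vb := fun r t h => bour_curve_velocity m 1 _ hm1 hm2 hm3 (hv r t h)).
assert (na := fun r t h => bour_velocity_null m (-1) _ (hc r t h) ltac:(ring)).
assert (nb := fun r t h => bour_velocity_null m 1 _ (hv r t h) ltac:(ring)).
assert (imm : forall r t, D (r, t) -> immersion_at (bour m) r t).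
{ intros r t h; destruct (him r t h) as [i | [hr hp]]; [exact i |].
  eapply sum_immersion; eauto. }
split; [split; [split; [| split; [| split]] |] |]; try assumption.
- apply bour_smooth; assumption.
- intros r t h; eapply lorentzian_sum; eauto.
- intros r t h; eapply mean_curvature_sum; eauto.
  + intros r' t' h'; apply bour_velocity_diff; auto.
  + intros r' t' h'; apply bour_velocity_diff; auto.
Qed.

Theorem theorem4 (m : R) (hm1 : m <> -1) (hm2 : m <> 0) (hm3 : m <> 1) :
  timelike_minimal_surface bour_quadrant (bour m) /\
  (forall D : R * R -> Prop,
     open D -> simply_connected D ->
     (forall r t : R, D (r, t) -> bour_defined m r t /\ immersion_at (bour m) r t) ->
     timelike_minimal_surface D (bour m)).
Proof.
split.
- assert (pos : forall r t, bour_quadrant (r, t) -> 0 < r /\ 0 < cos t /\ 0 < sin t).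
  { intros r t [h1 [h2 h3]]; simpl in *; split; [exact h1 | split].
    - apply cos_gt_0; lra.
    - apply sin_gt_0; lra. }
  apply bour_immersion_timelike_minimal; auto using quadrant_open,
    quadrant_simply_connected; intros r t h; destruct (pos r t h) as [hr [hc hs]].
  + intros x a [-> | [-> | ->]] _; left; assumption.
  + right; split; [lra |].
    apply Rgt_not_eq, bour_velocity_quadrant; apply Rmult_lt_0_compat; assumption.
- intros D hD hsc h; apply bour_immersion_timelike_minimal; auto;
    intros r t hrt; [| left]; apply (h r t hrt).
Qed.
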